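(* Let $d \ge 1$ and $N \ge 1$ be integers. Let $G \in \mathbb{R}^{N\times N}$ be the hyperbolic Gramian (H-Gramian) of a set of points $x_1,\dots,x_N \in \mathbb{L}^d$. Then there exist matrices $G^{+}, G^{-} \in \mathbb{R}^{N\times N}$ such that $$G = G^{+} - G^{-},$$ where $$G^{+} \succeq 0,\quad G^{-} \succeq 0,\quad \operatorname{rank}(G^{+}) \le d,\quad \operatorname{rank}(G^{-}) \le 1,$$ and moreover every diagonal entry of $G$ equals $-1$, and $e_i^{\top} G e_j \le -1$ for all $i,j \in \{1,\dots,N\}$. Conversely, let $G \in \mathbb{R}^{N\times N}$ be any matrix such that every diagonal entry of $G$ equals $-1$, $e_i^{\top} G e_j \le -1$ for all $i,j \in \{1,\dots,N\}$, and $G = G^{+} - G^{-}$ for some matrices $G^{+}, G^{-} \in \mathbb{R}^{N\times N}$ with $G^{+} \succeq 0$, $G^{-} \succeq 0$, $\operatorname{rank}(G^{+}) \le d$ and $\operatorname{rank}(G^{-}) \le 1$. Then $G$ is the hyperbolic Gramian of some $N$ points in $\mathbb{L}^d$.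
   Context: Let $H = \operatorname{diag}(-1,1,\dots,1) \in \mathbb{R}^{(d+1)\times(d+1)}$. The Lorentzian inner product of $x,y\in\mathbb{R}^{d+1}$ is $[x,y] = x^{\top} H y$. Coordinates of $x\in\mathbb{R}^{d+1}$ are indexed $x_0,\dots,x_d$. The 'Loid (hyperboloid) model is $$\mathbb{L}^d = \{x\in\mathbb{R}^{d+1} : [x,x] = -1,\ x_0>0\}.$$ The hyperbolic Gramian (H-Gramian) of points $x_1,\dots,x_N\in\mathbb{L}^d$ is $G = ([x_i,x_j])_{i,j=1}^N = X^{\top} H X$, where $X=[x_1,\dots,x_N]\in\mathbb{R}^{(d+1)\times N}$. The notation $A \succeq 0$ means $A$ is symmetric positive semidefinite, and $e_i$ denotes the $i$-th standard basis vector of $\mathbb{R}^N$. *)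

(* Defs.v *)
From mathcomp Require Import all_boot all_order all_algebra.
From mathcomp Require Import reals.

Set Implicit Arguments.
Unset Strict Implicit.
Unset Printing Implicit Defensive.

Import Order.TTheory GRing.Theory Num.Theory.
Local Open Scope ring_scope.

Section Hyperboloid.
Variable R : realType.

(* H = diag(-1, 1, ..., 1); the coordinate x_0 has index ord0 : 'I_d.+1. *)
Definition lorentz_mx (d : nat) : 'M[R]_d.+1 :=
  diag_mx (\row_(j < d.+1) (if j == ord0 then -1 else 1)).

Definition lorentz (d : nat) (x y : 'cV[R]_d.+1) : R :=
  (x^T *m lorentz_mx d *m y) 0 0.

Definition loid (d : nat) (x : 'cV[R]_d.+1) : Prop :=
  lorentz x x = -1 /\ 0 < x ord0 0.

Definition hgram (d N : nat) (x : 'I_N -> 'cV[R]_d.+1) : 'M[R]_N :=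
  \matrix_(i < N, j < N) lorentz (x i) (x j).

Lemma hgramE (d N : nat) (x : 'I_N -> 'cV[R]_d.+1) :
  let X := \matrix_(k < d.+1, i < N) x i k 0 in
  hgram x = X^T *m lorentz_mx d *m X.
Proof.
move=> X; have colX i : col i X = x i.
  by apply/matrixP => k l; rewrite !mxE ord1.
apply/matrixP => i j; rewrite mxE /lorentz -!colX.
rewrite tr_col -row_mul mxE [RHS]mxE.
by apply: eq_bigr => k _; rewrite mxE [X in _ * X = _]mxE.
Qed.

(* The points need not be distinct. *)
Definition is_hgram (d N : nat) (G : 'M[R]_N) : Prop :=
  exists x : 'I_N -> 'cV[R]_d.+1, (forall i, loid (x i)) /\ G = hgram x.

Definition psd (n : nat) (A : 'M[R]_n) : Prop :=
  A^T = A /\ forall u : 'cV[R]_n, 0 <= (u^T *m A *m u) 0 0.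

Definition std_basis (n : nat) (i : 'I_n) : 'cV[R]_n := delta_mx i 0.

End Hyperboloid.

(* Main.v *)
(* The spacelike coordinates of the points give [G+] and the timelike one gives
   [G-]. Conversely, factor [G+ = V^T V] with [V] having [d] rows, by symmetric
   Gaussian elimination, and [G- = w^T w], and take the points [(+-w_i, v_i)].
   Since [w_i^2 = 1 + |v_i|^2], the inequality [0 <= |w_j v_i - w_i v_j|^2] reads
   [w_i^2 + w_j^2 <= -2 w_i w_j G_ij]. For positive [w] this gives [G_ij <= -1];
   for [G_ij < 0] it shows that all [w_i] have the same sign, so that one global
   change of sign of [w] puts every point on the upper sheet. *)

Require Import Defs.
From mathcomp Require Import all_boot all_order all_algebra.
From mathcomp Require Import reals.
From mathcomp Require Import ring lra.
Import Order.TTheory GRing.Theory Num.Theory.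
Local Open Scope ring_scope.

Lemma std_basis_formE {R : realType} {n : nat} (A : 'M[R]_n) (i j : 'I_n) :
  ((std_basis R i)^T *m A *m std_basis R j) 0 0 = A i j.
Proof. by rewrite /std_basis trmx_delta -rowE -colE !mxE. Qed.

Lemma gramE {R : realType} {m n : nat} (V : 'M[R]_(m, n)) (i j : 'I_n) :
  (V^T *m V) i j = \sum_k V k i * V k j.
Proof. by rewrite mxE; apply: eq_bigr => k _; rewrite mxE. Qed.

Lemma gram1E {R : realType} {n : nat} (w : 'rV[R]_n) (i j : 'I_n) :
  (w^T *m w) i j = w 0 i * w 0 j.
Proof. by rewrite gramE big_ord1. Qed.

Lemma psd_gram {R : realType} {m n : nat} (V : 'M[R]_(m, n)) : psd (V^T *m V).
Proof.
split=> [|u]; first by rewrite trmx_mul trmxK.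
rewrite mulmxA -trmx_mul -mulmxA gramE.
by apply: sumr_ge0 => k _; rewrite -expr2 sqr_ge0.
Qed.

Lemma rank_gram {R : realType} {m n : nat} (V : 'M[R]_(m, n)) :
  (\rank (V^T *m V) <= m)%N.
Proof. exact: leq_trans (mxrankM_maxr _ _) (rank_leq_row _). Qed.

Lemma psd_sym {R : realType} {n : nat} {A : 'M[R]_n} (i j : 'I_n) :
  psd A -> A i j = A j i.
Proof. by case=> sA _; rewrite -[in LHS]sA mxE. Qed.

Lemma quad_form_addZ {R : realType} {n : nat} (A : 'M[R]_n) (u v : 'cV[R]_n) (t : R) :
  ((u + t *: v)^T *m A *m (u + t *: v)) 0 0 =
  (u^T *m A *m u) 0 0 + t * (u^T *m A *m v) 0 0
  + t * (v^T *m A *m u) 0 0 + t ^+ 2 * (v^T *m A *m v) 0 0.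
Proof.
have -> : (u + t *: v)^T = u^T + t *: v^T.
  by apply/matrixP => i j; rewrite !mxE.
rewrite !mulmxDl !mulmxDr -!scalemxAl -!scalemxAr.
have D (a b : 'M[R]_1) : (a + b) 0 0 = a 0 0 + b 0 0 by rewrite mxE.
have Z c (a : 'M[R]_1) : (c *: a) 0 0 = c * a 0 0 by rewrite mxE.
by rewrite !(D, Z); ring.
Qed.

Lemma psd_diag_ge0 {R : realType} {n : nat} {A : 'M[R]_n} (i : 'I_n) :
  psd A -> 0 <= A i i.
Proof. by case=> _ /(_ (std_basis R i)); rewrite std_basis_formE. Qed.

(** With a zero diagonal, the form at [e_i + t e_j] is [2 t A i j], linear in [t]; nonnegativity at
    [t = 1] and [t = -1] forces [A i j = 0]. *)
Lemma psd_diag0 {R : realType} {n : nat} {A : 'M[R]_n} :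
  psd A -> (forall i, A i i = 0) -> A = 0.
Proof.
move=> pA dA; apply/matrixP => i j; rewrite [RHS]mxE.
have test t : 0 <= t * (A i j + A i j).
  have [_ /(_ (std_basis R i + t *: std_basis R j))] := pA.
  rewrite quad_form_addZ !std_basis_formE !dA (psd_sym j i pA) => h; lra.
have := test 1; have := test (-1); lra.
Qed.

(** The scaling makes the Gram matrix of this row the rank-one term removed by elimination at the
    pivot [A i i], so the row can serve directly as a row of the factor [V]. *)
Definition pivot_row {R : realType} {n : nat} (A : 'M[R]_n) (i : 'I_n) : 'rV[R]_n :=
  (Num.sqrt (A i i))^-1 *: row i A.

Definition schur {R : realType} {n : nat} (A : 'M[R]_n) (i : 'I_n) : 'M[R]_n :=
  A - (pivot_row A i)^T *m pivot_row A i.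

Lemma schurE {R : realType} {n : nat} {A : 'M[R]_n} (i : 'I_n) :
  psd A -> schur A i = A - (A i i)^-1 *: (col i A *m row i A).
Proof.
move=> pA; have [sA _] := pA.
rewrite /schur /pivot_row; set c := (Num.sqrt _)^-1.
have -> : (c *: row i A)^T = c *: col i A.
  by rewrite -[in RHS]sA -tr_row; apply/matrixP => k l; rewrite !mxE.
rewrite -scalemxAl -scalemxAr scalerA.
by rewrite -invfM -expr2 sqr_sqrtr ?psd_diag_ge0.
Qed.

Lemma psd_schur {R : realType} {n : nat} {A : 'M[R]_n} {i : 'I_n} :
  psd A -> 0 < A i i -> psd (schur A i).
Proof.
move=> pA Ai; have [sA qA] := pA; split=> [|u].
  by rewrite /schur linearB /= trmx_mul trmxK sA.
(* Completing the square: the form of the Schur complement at [u] is the form of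
   [A] at the [A]-orthogonal projection of [u] along [e_i]. *)
set e := std_basis R i; set c := (e^T *m A *m u) 0 0.
(* The two cross terms agree: a 1 by 1 matrix equals its transpose, and [A] is symmetric. *)
have cE : (u^T *m A *m e) 0 0 = c.
  have : (u^T *m A *m e)^T = e^T *m A *m u by rewrite !trmx_mul trmxK sA mulmxA.
  by move/matrixP/(_ 0 0); rewrite mxE.
have -> : (u^T *m schur A i *m u) 0 0 = (u^T *m A *m u) 0 0 - (A i i)^-1 * c ^+ 2.
  rewrite schurE // mulmxBr mulmxBl -scalemxAr -scalemxAl.
  have -> : row i A = e^T *m A by rewrite /e /std_basis trmx_delta rowE.
  rewrite colE -/(std_basis R i) -/e.
  have -> : u^T *m (A *m e *m (e^T *m A)) *m u = (u^T *m A *m e) *m (e^T *m A *m u).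
    by rewrite !mulmxA.
  rewrite mxE [X in _ + X = _]mxE [X in _ - X = _]mxE.
  by rewrite [X in _ - _ * X = _]mxE big_ord1 cE.
have := qA (u + (- (c / A i i)) *: e).
rewrite quad_form_addZ cE -/c std_basis_formE.
by congr (0 <= _); field; rewrite gt_eqF.
Qed.

(** The Schur complement is a left multiple of [A], so its row space lies in that of [A]. The
    inclusion is strict: the complement kills [e_i], whereas [A e_i] has the positive entry
    [A i i]. *)
Lemma rank_schur {R : realType} {n : nat} {A : 'M[R]_n} {i : 'I_n} :
  psd A -> 0 < A i i -> (\rank (schur A i) < \rank A)%N.
Proof.
move=> pA Ai; apply: rank_ltmx; rewrite ltmxE; apply/andP; split.
  rewrite schurE // rowE mulmxA scalemxAl -{1}[A]mul1mx -mulmxBl.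
  exact: submxMl.
apply/negP => /submxP [D AE].
have Si : schur A i *m std_basis R i = 0.
  rewrite schurE // mulmxBl -scalemxAl -mulmxA /std_basis -!colE.
  apply/matrixP => k l; rewrite !mxE big_ord1 !mxE mulrCA mulVf ?gt_eqF //.
  by rewrite mulr1 subrr.
have : (A *m std_basis R i) i 0 = 0 by rewrite AE -mulmxA Si mulmx0 mxE.
by rewrite /std_basis -colE mxE => Ai0; rewrite Ai0 ltxx in Ai.
Qed.

(** Induction on the rank bound: each pivot contributes one row of [V] and lowers the rank. If no
    pivot is left, [A] vanishes and the remaining rows are zero. *)
Lemma psd_factor {R : realType} {n d : nat} {A : 'M[R]_n} :
  psd A -> (\rank A <= d)%N -> exists V : 'M[R]_(d, n), A = V^T *m V.
Proof.
elim: d A => [|d IHd] A pA rA.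
  exists 0; rewrite mulmx0; apply/eqP.
  by rewrite -mxrank_eq0 -leqn0.
have [/forallP dA|] := boolP [forall i, A i i == 0].
  exists 0; rewrite mulmx0; apply: psd_diag0 => // i; exact/eqP/dA.
rewrite negb_forall => /existsP[i Ai0].
have Ai : 0 < A i i by rewrite lt_def Ai0 psd_diag_ge0.
have rS : (\rank (schur A i) <= d)%N.
  by rewrite -ltnS; apply: leq_trans rA; exact: rank_schur.
have [V SE] := IHd _ (psd_schur pA Ai) rS.
have AE : A = (col_mx (pivot_row A i) V)^T *m col_mx (pivot_row A i) V.
  by rewrite tr_col_mx mul_row_col -SE /schur addrC subrK.
by exists (col_mx (pivot_row A i) V).
Qed.

Lemma lorentzE {R : realType} {d : nat} (x y : 'cV[R]_d.+1) :
  lorentz x y =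
  \sum_(k < d) x (lift ord0 k) 0 * y (lift ord0 k) 0 - x 0 0 * y 0 0.
Proof.
rewrite /lorentz /lorentz_mx -mulmxA mul_diag_mx mxE big_ord_recl addrC.
congr (_ + _); last by rewrite !mxE eqxx mulN1r mulrN.
by apply: eq_bigr => k _; rewrite !mxE /= mul1r.
Qed.

Lemma hgram_split {R : realType} {d N : nat} (x : 'I_N -> 'cV[R]_d.+1) :
  let V := \matrix_(k < d, i < N) x i (lift ord0 k) 0 in
  let w := \row_(i < N) x i 0 0 in
  hgram x = V^T *m V - w^T *m w.
Proof.
move=> V w; apply/matrixP => i j.
rewrite mxE lorentzE [RHS]mxE gramE [X in _ = _ + X]mxE gram1E !mxE.
by congr (_ - _); apply: eq_bigr => k _; rewrite !mxE.
Qed.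

Lemma split_ineq {R : realType} {d N : nat} {V : 'M[R]_(d, N)} {w : 'rV[R]_N}
    {G : 'M[R]_N} {i j : 'I_N} :
  G = V^T *m V - w^T *m w -> G i i = -1 -> G j j = -1 ->
  w 0 i ^+ 2 + w 0 j ^+ 2 <= 2 * (w 0 i * w 0 j) * - G i j.
Proof.
have entry k l : (V^T *m V - w^T *m w) k l = (V^T *m V) k l - w 0 k * w 0 l.
  by rewrite mxE [X in _ + X]mxE gram1E.
move=> ->; rewrite !entry !gramE => Gii Gjj.
have : 0 <= \sum_k (w 0 j * V k i - w 0 i * V k j) ^+ 2.
  by apply: sumr_ge0 => k _; exact: sqr_ge0.
have -> : \sum_k (w 0 j * V k i - w 0 i * V k j) ^+ 2 =
    w 0 j ^+ 2 * (\sum_k V k i * V k i) + w 0 i ^+ 2 * (\sum_k V k j * V k j)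
    - 2 * (w 0 i * w 0 j) * \sum_k V k i * V k j.
  rewrite !mulr_sumr -big_split -sumrB /=.
  by apply: eq_bigr => k _; ring.
(* The unit diagonal conditions eliminate the norms of the [v_i]; the quartic terms in [w] then
   cancel. *)
have -> : \sum_k V k i * V k i = w 0 i ^+ 2 - 1 by lra.
have -> : \sum_k V k j * V k j = w 0 j ^+ 2 - 1 by lra.
by move=> h; rewrite -subr_ge0 in h *; lra.
Qed.

Theorem proposition3p2 (R : realType) (d N : nat) (hd : (1 <= d)%N) (hN : (1 <= N)%N) :
  (forall G : 'M[R]_N, is_hgram d G ->
     (exists Gp Gm : 'M[R]_N,
        G = Gp - Gm /\ psd Gp /\ psd Gm /\
        (\rank Gp <= d)%N /\ (\rank Gm <= 1)%N) /\
     (forall i : 'I_N, G i i = -1) /\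
     (forall i j : 'I_N,
        ((std_basis R i)^T *m G *m std_basis R j) 0 0 <= -1))
  /\
  (forall G : 'M[R]_N,
     (forall i : 'I_N, G i i = -1) ->
     (forall i j : 'I_N,
        ((std_basis R i)^T *m G *m std_basis R j) 0 0 <= -1) ->
     (exists Gp Gm : 'M[R]_N,
        G = Gp - Gm /\ psd Gp /\ psd Gm /\
        (\rank Gp <= d)%N /\ (\rank Gm <= 1)%N) ->
     is_hgram d G).
Proof.
split=> [G [x [lx GE]]|G Gd Gle [Gp [Gm [GE [pGp [pGm [rGp rGm]]]]]]].
- have GS := hgram_split x; rewrite -GE /= in GS.
  have Gd i : G i i = -1 by rewrite GE mxE; case: (lx i).
  split; last split=> // i j; rewrite ?std_basis_formE.
    by do 2 eexists; split; [exact: GS|]; split; [exact: psd_gram|];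
      split; [exact: psd_gram|]; split; exact: rank_gram.
  have := split_ineq GS (Gd i) (Gd j); rewrite !mxE.
  have [_ wi] := lx i; have [_ wj] := lx j.
  (* The square gives [2 w_i w_j <= w_i^2 + w_j^2]; chaining with the previous bound leaves a factor
     [w_i w_j > 0] to cancel. *)
  have p := mulr_gt0 wi wj; have := sqr_ge0 (x i 0 0 - x j 0 0).
  rewrite -[_ <= -1](ler_pM2l p) => h1 h2; lra.
- have [V VE] := psd_factor pGp rGp; have [w wE] := psd_factor pGm rGm.
  rewrite {}VE {}wE in GE.
  have w2_gt0 i : 0 < w 0 i ^+ 2.
    have := Gd i; rewrite GE mxE [X in _ + X]mxE gram1E.
    have := psd_diag_ge0 i (psd_gram V); rewrite expr2; lra.
  (* The point [i0] is a reference: every [w_i] is compared with [w_i0], and [s] is the global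
     sign. *)
  pose i0 := Ordinal hN; pose s := Num.sg (w 0 i0).
  have ww i : 0 < w 0 i * w 0 i0.
    have := split_ineq GE (Gd i) (Gd i0).
    have := Gle i i0; rewrite std_basis_formE => g.
    have gp : 0 < - G i i0 by lra.
    have := w2_gt0 i; have := w2_gt0 i0 => h1 h2 h3.
    by rewrite -(pmulr_lgt0 _ gp); lra.
  have ss : s * s = 1.
    by rewrite -expr2 sqr_sg -sqrf_eq0 gt_eqF.
  pose x i : 'cV[R]_d.+1 :=
    \col_k (if unlift ord0 k is Some k' then V k' i else s * w 0 i).
  have x0 i : x i 0 0 = s * w 0 i by rewrite mxE unlift_none.
  have xS i k : x i (lift ord0 k) 0 = V k i by rewrite mxE liftK.
  have Gx : G = hgram x.
    rewrite hgram_split GE.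
    have -> : \matrix_(k < d, i < N) x i (lift ord0 k) 0 = V.
      by apply/matrixP => k i; rewrite mxE xS.
    have -> : \row_(i < N) x i 0 0 = s *: w.
      by apply/rowP => i; rewrite mxE x0 mxE.
    congr (_ - _); apply/matrixP => i j; rewrite !gram1E !mxE.
    by rewrite mulrACA ss mul1r.
  exists x; split=> // i; split.
    by have := Gd i; rewrite Gx mxE.
  (* The time coordinate [s * w_i] has the sign of [w_i * w_i0], which is positive by [ww]. *)
  by rewrite x0 mulrC -sgr_gt0 sgrM sgr_id -sgrM sgr_gt0.
Qed.
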